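(* Let $R$ be a ring and let $M$ be a cu-uniserial left $R$-module. Then $M$ is uniform and B\'ezout.
   Context: All rings are associative with identity and all modules are unitary left modules. For a module $K$, $\mathrm{Rad}(K)$ denotes the intersection of all maximal submodules of $K$ (equal to $K$ if there are none). A submodule is essential if it has nonzero intersection with every nonzero submodule; a nonzero module is uniform if every nonzero submodule of it is essential. A left $R$-module $M$ is cyclic-uniform uniserial (cu-uniserial) if for every finitely generated submodule $0\neq K\subseteq M$, the module $K/\mathrm{Rad}(K)$ is cyclic and uniform. A module is B\'ezout if every finitely generated submodule of it is cyclic. *)

(* Defs.v *)
From HB Require Import structures.
From mathcomp Require Import all_boot all_algebra.
From mathcomp Require Import boolp.

Set Implicit Arguments.
Unset Strict Implicit.
Unset Printing Implicit Defensive.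

Import GRing.Theory.
Local Open Scope ring_scope.
Local Open Scope quotient_scope.

(* Rings are [pzRingType]s (so the zero ring is allowed), left modules are
   [lmodType]s and submodules of V are inhabitants of [submodClosed V].  These
   are boolean predicates; with the classical axioms of [boolp] every
   Prop-valued submodule is of this form. *)

Section SubmoduleAsModule.
Variables (R : pzRingType) (V : lmodType R) (K : submodClosed V).

Record submod_of := SubmodOf { submod_val :> V; _ : submod_val \in K }.

HB.instance Definition _ := [isSub for submod_val].
HB.instance Definition _ := [Choice of submod_of by <:].
HB.instance Definition _ := [SubChoice_isSubLmodule of submod_of by <:].

End SubmoduleAsModule.

Section QuotientModule.
Variables (R : pzRingType) (V : lmodType R) (N : submodClosed V).

Fact submod_zmod_closed : zmod_closed N.
Proof. exact: submodClosedP. Qed.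

(* [Quotient.quot] needs a [zmodClosed] structure. *)
Definition submod_zpred : {pred V} := fun x => x \in N.
HB.instance Definition _ :=
  GRing.isZmodClosed.Build V submod_zpred submod_zmod_closed.

Definition quot_mod := Quotient.quot (submod_zpred : zmodClosed V).
HB.instance Definition _ := GRing.Zmodule.on quot_mod.
HB.instance Definition _ := ZmodQuotient.on quot_mod.

Definition quot_scale (a : R) := lift_op1 quot_mod ( *:%R a).

Lemma pi_quot_modP (x y : V) :
  reflect (\pi_quot_mod x = \pi_quot_mod y) (x - y \in N).
Proof.
by rewrite -[x - y \in N]/(x - y \in submod_zpred) Quotient.idealrBE; apply: eqP.
Qed.

Lemma pi_quot_scale (a : R) (x : V) :
  \pi_quot_mod (a *: x) = quot_scale a (\pi_quot_mod x).
Proof.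
unlock quot_scale; apply/pi_quot_modP; rewrite -scalerBr; apply: rpredZ.
by apply/pi_quot_modP; rewrite reprK.
Qed.

Lemma quot_scaleA a b q : quot_scale a (quot_scale b q) = quot_scale (a * b) q.
Proof. by elim/quotW: q => x; rewrite -!pi_quot_scale scalerA. Qed.

Lemma quot_scale1 : left_id 1 quot_scale.
Proof. by elim/quotW=> x; rewrite -pi_quot_scale scale1r. Qed.

Lemma quot_scaleDr : right_distributive quot_scale +%R.
Proof.
move=> a; elim/quotW=> x; elim/quotW=> y.
by rewrite -raddfD -!pi_quot_scale scalerDr raddfD.
Qed.

Lemma quot_scaleDl q : {morph quot_scale^~ q : a b / a + b}.
Proof.
by move=> a b; elim/quotW: q => x; rewrite -!pi_quot_scale scalerDl raddfD.
Qed.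

HB.instance Definition _ := GRing.Zmodule_isLmodule.Build R quot_mod
  quot_scaleA quot_scale1 quot_scaleDr quot_scaleDl.

End QuotientModule.

Section ModuleNotions.
Variable R : pzRingType.
Implicit Type V : lmodType R.

Definition nonzero_mod V : Prop := exists x : V, x != 0.

Definition nonzero_submod V (K : submodClosed V) : Prop :=
  exists2 x, x \in K & x != 0.

Definition maximal_submod V (N : submodClosed V) : Prop :=
  (exists x, x \notin N) /\
  forall L : submodClosed V, {subset N <= L} ->
    {subset L <= N} \/ (forall x, x \in L).

Definition essential_submod V (N : submodClosed V) : Prop :=
  forall L : submodClosed V, nonzero_submod L ->
    exists x, [/\ x \in N, x \in L & x != 0].

Definition uniform_mod V : Prop :=
  nonzero_mod V /\
  forall N : submodClosed V, nonzero_submod N -> essential_submod N.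

Definition cyclic_mod V : Prop :=
  exists x : V, forall y : V, exists a : R, y = a *: x.

Definition fin_gen_mod V : Prop :=
  exists (n : nat) (g : 'I_n -> V),
    forall y : V, exists a : 'I_n -> R, y = \sum_(i < n) a i *: g i.

Definition bezout_mod V : Prop :=
  forall K : submodClosed V, fin_gen_mod (submod_of K) -> cyclic_mod (submod_of K).

End ModuleNotions.

Section Radical.
Variables (R : pzRingType) (V : lmodType R).

Definition Rad : {pred V} :=
  fun x => `[< forall N : submodClosed V, maximal_submod N -> x \in N >].

Fact Rad_submod_closed : submod_closed Rad.
Proof.
split=> [|a x y /asboolP Rx /asboolP Ry]; apply/asboolP => N maxN.
  exact: rpred0.
by rewrite rpredD ?rpredZ ?Rx ?Ry.
Qed.

HB.instance Definition _ := GRing.isSubmodClosed.Build R V Rad Rad_submod_closed.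

End Radical.

Definition top_mod (R : pzRingType) (V : lmodType R) : lmodType R :=
  quot_mod (Rad (V := V) : submodClosed V).

Definition cu_uniserial (R : pzRingType) (M : lmodType R) : Prop :=
  forall K : submodClosed M,
    fin_gen_mod (submod_of K) -> nonzero_submod K ->
    cyclic_mod (top_mod (submod_of K)) /\ uniform_mod (top_mod (submod_of K)).

(* Main.v *)
Require Import Defs.
From HB Require Import structures.
From mathcomp Require Import all_boot all_algebra.
From mathcomp Require Import boolp classical_sets.

(** Finitely generated modules have enough maximal submodules: by Zorn's lemma,
    every proper submodule of a finitely generated module lies in a maximal one
    ([fin_gen_maximal]).  Both halves of the theorem rest on this.

    Bezout.  If K is finitely generated then [Rad K] is superfluous
    ([Rad_superfluous]): a submodule L with L + Rad K = K cannot be proper,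
    since a maximal submodule above L would also contain [Rad K].  Hence a lift
    of a generator of K / Rad K generates K ([cyclic_top]).

    Uniform.  Suppose that a nonzero x and a nonzero y in M generate submodules
    meeting in 0, and let K = R x + R y, a direct sum.  A maximal submodule of K
    above R y omits x, so R x is not inside [Rad K], and neither is R y.  As
    K / Rad K is uniform, the images of R x and R y share a nonzero element,
    which means that a *: x - b *: y lies in [Rad K] for some a, b with a *: x
    outside it.  But the radical of a direct sum is compatible with the
    decomposition ([Rad_summand]), so a *: x lies in [Rad K]: contradiction.
    Thus a finitely generated module with uniform top is not a direct sum of two
    nonzero cyclic submodules ([uniform_top_indecomposable]). *)

Set Implicit Arguments.
Unset Strict Implicit.
Unset Printing Implicit Defensive.

Import GRing.Theory.
Local Open Scope ring_scope.
Local Open Scope quotient_scope.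

(** * Submodules given by propositions *)

Section SubmoduleComprehension.
Variables (R : pzRingType) (V : lmodType R).

(** Submodules being boolean predicates, a submodule described by a proposition
    has to be converted classically. *)
Definition asbool_pred (P : V -> Prop) : {pred V} := fun x => `[< P x >].

Variable P : V -> Prop.
Hypotheses (P0 : P 0) (Plin : forall a x y, P x -> P y -> P (a *: x + y)).

Fact asbool_pred_closed : submod_closed (asbool_pred P).
Proof.
by split=> [|a x y /asboolP Px /asboolP Py]; apply/asboolP; auto.
Qed.

Definition submod_where : submodClosed V :=
  HB.pack (asbool_pred P)
    (GRing.isSubmodClosed.Build R V (asbool_pred P) asbool_pred_closed).

Lemma submod_whereP x : reflect (P x) (x \in submod_where).
Proof. exact: asboolP. Qed.

End SubmoduleComprehension.

Section Constructions.
Variables (R : pzRingType) (V : lmodType R).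
Implicit Types (A B N : submodClosed V) (x : V).

Lemma submodB A x y : x \in A -> y \in A -> x - y \in A.
Proof. by move=> Ax Ay; rewrite -scaleN1r rpredD ?rpredZ. Qed.

Fact sum_has0 A B : exists2 a, a \in A & 0 - a \in B.
Proof. by exists 0; rewrite ?subrr rpred0. Qed.

Fact sum_linear A B (c : R) x y :
    (exists2 a, a \in A & x - a \in B) -> (exists2 a, a \in A & y - a \in B) ->
  exists2 a, a \in A & c *: x + y - a \in B.
Proof.
move=> [a Aa Ba] [b Ab Bb]; exists (c *: a + b); first by rewrite rpredD ?rpredZ.
by rewrite opprD addrACA -scalerBr rpredD ?rpredZ.
Qed.

(** Membership of x is phrased with the second summand x - a, which saves an
    existential quantifier. *)
Definition submod_sum A B : submodClosed V :=
  submod_where (sum_has0 A B) (@sum_linear A B).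

Lemma submod_sumP A B x :
  reflect (exists2 a, a \in A & x - a \in B) (x \in submod_sum A B).
Proof. exact: submod_whereP. Qed.

Lemma sum_subl A B : {subset A <= submod_sum A B}.
Proof. by move=> x Ax; apply/submod_sumP; exists x; rewrite ?subrr ?rpred0. Qed.

Lemma sum_subr A B : {subset B <= submod_sum A B}.
Proof. by move=> x Bx; apply/submod_sumP; exists 0; rewrite ?subr0 ?rpred0. Qed.

Fact line_has0 x : exists a : R, 0 = a *: x.
Proof. by exists 0; rewrite scale0r. Qed.

Fact line_linear x (c : R) y z :
    (exists a : R, y = a *: x) -> (exists a : R, z = a *: x) ->
  exists a : R, c *: y + z = a *: x.
Proof.
by move=> [a ->] [b ->]; exists (c * a + b); rewrite scalerDl scalerA.
Qed.

Definition line x : submodClosed V :=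
  submod_where (line_has0 x) (@line_linear x).

Lemma lineP x y : reflect (exists a : R, y = a *: x) (y \in line x).
Proof. exact: submod_whereP. Qed.

Lemma mem_line x : x \in line x.
Proof. by apply/lineP; exists 1; rewrite scale1r. Qed.

Fact meet_has0 A B : 0 \in A /\ 0 \in B.
Proof. by rewrite !rpred0. Qed.

Fact meet_linear A B (c : R) x y :
    x \in A /\ x \in B -> y \in A /\ y \in B ->
  c *: x + y \in A /\ c *: x + y \in B.
Proof. by move=> [? ?] [? ?]; rewrite !rpredD ?rpredZ. Qed.

Definition submod_meet A B : submodClosed V :=
  submod_where (meet_has0 A B) (@meet_linear A B).

Lemma submod_meetP A B x : reflect (x \in A /\ x \in B) (x \in submod_meet A B).
Proof. exact: submod_whereP. Qed.

(** The modular-lattice meaning of maximality: any element outside N generates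
    the whole module together with N. *)
Lemma maximal_split N x v :
  maximal_submod N -> x \notin N -> exists c : R, v - c *: x \in N.
Proof.
move=> [_ maxN] xN.
have [le|full] := maxN (submod_sum (line x) N) (@sum_subr _ _).
  by case/negP: xN; apply/le/sum_subl/mem_line.
by have /submod_sumP[_ /lineP[c ->] ?] := full v; exists c.
Qed.

End Constructions.

(** * Maximal submodules of finitely generated modules *)

Section FinitelyGenerated.
Variables (R : pzRingType) (V : lmodType R).
Hypothesis fgV : fin_gen_mod V.

(** The union of a chain of proper submodules is proper because finitely many
    generators, all lying in the union, would already lie in one member.  The
    submodule P is put into every chain to take care of the empty one. *)
Lemma fin_gen_maximal (P : submodClosed V) :
  (exists x, x \notin P) ->
  exists2 N, maximal_submod N & {subset P <= N}.
Proof.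
move=> properP; have [n [g gen]] := fgV.
pose T := {N : submodClosed V | {subset P <= N} /\ exists x, x \notin N}.
pose t0 : T := exist _ P (conj (fun _ Px => Px) properP).
pose le (s t : T) := `[< {subset sval s <= sval t} >].
have [|r s t /asboolP rs /asboolP st|C chainC|tmax maxT] :=
  @ZL_preorder T t0 le.
- by move=> t; apply/asboolP.
- by apply/asboolP => x /rs/st.
- pose D (t : T) := t = t0 \/ C t.
  have dirD (s t : T) : D s -> D t ->
      exists2 u : T, D u & {subset sval s <= sval u} /\ {subset sval t <= sval u}.
    have le0 (u : T) : {subset sval t0 <= sval u} by case: (svalP u).
    move=> [->|Cs] [->|Ct].
    + by exists t0; [left|split].
    + by exists t; [right|split].
    + by exists s; [right|split].
    + have [/asboolP st|/asboolP ts] := chainC s t Cs Ct.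
        by exists t; [right|split].
      by exists s; [right|split].
  pose U x := exists2 t, D t & x \in sval t.
  have U0 : U 0 by exists t0; [left|rewrite rpred0].
  have Ulin a x y : U x -> U y -> U (a *: x + y).
    move=> [s Ds sx] [t Dt ty]; have [u Du [su tu]] := dirD s t Ds Dt.
    exists u => //; apply: rpredD; [exact: rpredZ (su _ sx)|exact: tu].
  pose W := submod_where U0 Ulin.
  have PW : {subset P <= W}.
    by move=> x Px; apply/submod_whereP; exists t0; [left|].
  have properW : exists x, x \notin W.
    apply: contrapT => fullW.
    have allW x : x \in W.
      by apply: contrapT => /negP xW; apply: fullW; exists x.
    have [t _ tg] : exists2 t, D t & {in enum 'I_n, forall i, g i \in sval t}.
      elim: (enum 'I_n) => [|i s [t Dt tg]]; first by exists t0; [left|].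
      have /submod_whereP[r Dr ri] := allW (g i).
      have [u Du [ru tu]] := dirD r t Dr Dt.
      exists u => // j; rewrite inE => /predU1P[->|/tg/tu//]; exact: ru.
    have [_ [x /negP[]]] := svalP t; have [a ->] := gen x.
    by apply: rpred_sum => i _; rewrite rpredZ // tg ?mem_enum.
  exists (exist _ W (conj PW properW)) => s Cs; apply/asboolP => x sx.
  by apply/(submod_whereP U0 Ulin); exists s; [right|].
- have [PN properN] := svalP tmax.
  exists (sval tmax) => //; split=> // L NL.
  have [properL|fullL] := pselect (exists x, x \notin L).
    left; have PL : {subset P <= L} by move=> x /PN/NL.
    by apply/asboolP/(maxT (exist _ L (conj PL properL))); apply/asboolP.
  by right=> x; apply: contrapT => /negP xL; apply: fullL; exists x.
Qed.

Lemma RadP (x : V) :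
  reflect (forall N : submodClosed V, maximal_submod N -> x \in N)
          (x \in Rad (V := V)).
Proof. exact: asboolP. Qed.

(** Nakayama's lemma in the form: the radical is superfluous. *)
Lemma Rad_superfluous (L : submodClosed V) :
  (forall v, exists2 l, l \in L & v - l \in Rad (V := V)) -> forall v, v \in L.
Proof.
move=> LRad v; apply: contrapT => /negP vL.
have [|N maxN LN] := @fin_gen_maximal L; first by exists v.
have [[x xN] _] := maxN; case/negP: xN.
have [l /LN Nl /RadP/(_ _ maxN) Nx] := LRad x.
by rewrite -(subrK l x) rpredD.
Qed.

(** If x generates V modulo its radical then R x + Rad V = V, so R x = V. *)
Lemma cyclic_top : cyclic_mod (top_mod V) -> cyclic_mod V.
Proof.
move=> [q genq]; exists (repr q) => y; apply/lineP/Rad_superfluous => {y} v.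
have [a va] := genq (\pi_(quot_mod (Rad (V := V))) v).
exists (a *: repr q); first by apply/lineP; exists a.
apply/(@pi_quot_modP R V (Rad (V := V))).
by rewrite pi_quot_scale reprK.
Qed.

End FinitelyGenerated.

(** * Uniform quotients *)

Section QuotientImage.
Variables (R : pzRingType) (V : lmodType R) (N A : submodClosed V).
Let pi x := \pi_(quot_mod N) x.

Fact image_has0 : exists2 x, x \in A & 0 = pi x.
Proof. by exists 0; rewrite ?rpred0 /pi ?raddf0. Qed.

Fact image_linear (c : R) (p q : quot_mod N) :
    (exists2 x, x \in A & p = pi x) -> (exists2 x, x \in A & q = pi x) ->
  exists2 x, x \in A & c *: p + q = pi x.
Proof.
move=> [x Ax ->] [y Ay ->]; exists (c *: x + y); first by rewrite rpredD ?rpredZ.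
by rewrite /pi raddfD /= pi_quot_scale.
Qed.

Definition quot_image : submodClosed (quot_mod N) :=
  submod_where image_has0 image_linear.

Lemma quot_imageP q :
  reflect (exists2 x, x \in A & q = pi x) (q \in quot_image).
Proof. exact: submod_whereP. Qed.

Lemma pi_eq0 x : (pi x == 0) = (x \in N).
Proof.
rewrite -[0](raddf0 \pi_(quot_mod N)).
by apply/eqP/idP => [/pi_quot_modP|xN]; [|apply/pi_quot_modP]; rewrite subr0.
Qed.

Lemma quot_image_nonzero x :
  x \in A -> x \notin N -> nonzero_submod quot_image.
Proof.
by move=> Ax xN; exists (pi x); [apply/quot_imageP; exists x|rewrite pi_eq0].
Qed.

End QuotientImage.

Section DirectSums.
Variables (R : pzRingType) (V : lmodType R).
Implicit Types (A B N : submodClosed V) (a b x y : V).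

(** Uniformity of V / N, read upstairs: the images of A and B in V / N share a
    nonzero element as soon as both are nonzero. *)
Lemma uniform_quot_meet N A B x y :
    uniform_mod (quot_mod N) ->
    x \in A -> x \notin N -> y \in B -> y \notin N ->
  exists a b, [/\ a \in A, b \in B, a \notin N & a - b \in N].
Proof.
move=> [_ ess] Ax xN By yN.
have [q [/quot_imageP[a Aa qa] /quot_imageP[b Bb qb] q0]] :=
  ess _ (quot_image_nonzero Ax xN) _ (quot_image_nonzero By yN).
exists a, b; split=> //; first by rewrite -pi_eq0 -qa.
by apply/pi_quot_modP; rewrite -qa.
Qed.

(** If N is maximal and a in A lies outside N, then (A meet N) + B is maximal,
    being the preimage of N under the projection of V onto A along B; hence it
    contains every element of the radical. *)
Lemma Rad_summand A B a b :
    (forall v, v \in submod_sum A B) ->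
    (forall x, x \in A -> x \in B -> x = 0) ->
    a \in A -> b \in B ->
  a - b \in Rad (V := V) -> a \in Rad (V := V).
Proof.
move=> sumAB dirAB Aa Bb /RadP Rab; apply/RadP => N maxN.
apply: contrapT => /negP aN.
pose N' := submod_sum (submod_meet A N) B.
(* N' gains no element of A, because A and B meet in 0. *)
have N'A x : x \in A -> x \in N' -> x \in N.
  move=> Ax /submod_sumP[x' /submod_meetP[Ax' Nx'] Bx].
  by rewrite (subr0_eq (dirAB _ (submodB Ax Ax') Bx)).
have maxN' : maximal_submod N'.
  split=> [|L N'L]; first by exists a; apply: contra aN; apply: N'A.
  have [[z [Lz zN']]|noz] := pselect (exists z, z \in L /\ z \notin N'); last first.
    by left=> z Lz; apply: contrapT => /negP zN'; apply: noz; exists z.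
  right=> w; have BL c : c \in B -> c \in L by move=> Bc; apply/N'L/sum_subr.
  have /submod_sumP[z1 Az1 Bz] := sumAB z.
  have Lz1 : z1 \in L by rewrite -(subKr z z1); apply: submodB (Lz) (BL _ Bz).
  have z1N : z1 \notin N.
    apply: contra zN' => Nz1; apply/submod_sumP; exists z1 => //.
    exact/submod_meetP.
  have /submod_sumP[w1 Aw1 Bw] := sumAB w.
  have [c Nw] := maximal_split w1 maxN z1N.
  have /N'L Lw : w1 - c *: z1 \in N'.
    by apply/sum_subl/submod_meetP; split; first by apply: submodB => //; apply: rpredZ.
  have Lw1 : w1 \in L by rewrite -(subrK (c *: z1) w1) rpredD ?rpredZ.
  by rewrite -(subrK w1 w); apply: rpredD (BL _ Bw) Lw1.
case/negP: aN; apply: N'A => //.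
by rewrite -(subrK b a) rpredD ?Rab //; apply: sum_subr.
Qed.

(** As V is finitely generated and B is proper, some maximal submodule contains
    B; it cannot also contain x, which together with B generates V. *)
Lemma complement_not_Rad B x :
    fin_gen_mod V -> (forall v, v \in submod_sum (line x) B) -> x \notin B ->
  x \notin Rad (V := V).
Proof.
move=> fgV sumxB xB; have [|N maxN BN] := fin_gen_maximal fgV (P := B).
  by exists x.
apply/negP => /RadP/(_ _ maxN) Nx; have [[v vN] _] := maxN; case/negP: vN.
have /submod_sumP[_ /lineP[c ->] /BN Nv] := sumxB v.
by rewrite -(subrK (c *: x) v) rpredD ?rpredZ.
Qed.

Lemma uniform_top_indecomposable x y :
    fin_gen_mod V -> uniform_mod (top_mod V) -> x != 0 -> y != 0 ->
    (forall v, v \in submod_sum (line x) (line y)) ->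
  exists2 z, z != 0 & z \in line x /\ z \in line y.
Proof.
move=> fgV uV x0 y0 sumxy; apply: contrapT => disj.
have dir z : z \in line x -> z \in line y -> z = 0.
  by move=> zx zy; apply: contrapT => /eqP z0; apply: disj; exists z.
have sumyx v : v \in submod_sum (line y) (line x).
  have /submod_sumP[u ux vy] := sumxy v.
  by apply/submod_sumP; exists (v - u); rewrite // subKr.
have xy : x \notin line y.
  by apply: contra x0 => xy; apply/eqP/dir; rewrite ?mem_line.
have yx : y \notin line x.
  by apply: contra y0 => yx; apply/eqP/dir; rewrite ?mem_line.
have xRad : x \notin Rad (V := V) by apply: complement_not_Rad sumxy xy.
have yRad : y \notin Rad (V := V) by apply: complement_not_Rad sumyx yx.
have [a [b [ax yb aRad abRad]]] :=
  uniform_quot_meet uV (mem_line x) xRad (mem_line y) yRad.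
by case/negP: aRad; apply: Rad_summand sumxy dir ax yb abRad.
Qed.

End DirectSums.

(** * Two-generated submodules of a cu-uniserial module *)

(** The sum of R x and R y, taken as a module in its own right, still splits as a
    sum of two cyclic submodules, so that the results on an ambient module V
    apply to it. *)
Lemma submod_of_plane (R : pzRingType) (M : lmodType R) (x y : M)
    (K := submod_sum (line x) (line y)) :
  exists u v : submod_of K, [/\ val u = x, val v = y
    & forall w, w \in submod_sum (line u) (line v)].
Proof.
pose u : submod_of K := Sub x (sum_subl _ (mem_line x)).
pose v : submod_of K := Sub y (sum_subr _ (mem_line y)).
have [ux vy] : val u = x /\ val v = y by rewrite !SubK.
exists u, v; split=> // w.
have /submod_sumP[_ /lineP[a ->] /lineP[b wb]] := valP w.
apply/submod_sumP; exists (a *: u); first by apply/lineP; exists a.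
apply/lineP; exists b; apply: val_inj.
by rewrite raddfB !linearZ /= scalerN wb.
Qed.

Lemma fin_gen_plane (R : pzRingType) (V : lmodType R) (x y : V) :
  (forall v, v \in submod_sum (line x) (line y)) -> fin_gen_mod V.
Proof.
move=> sumxy; exists 2%N, (fun i => if i == ord0 then x else y) => v.
have /submod_sumP[_ /lineP[a ->] /lineP[b vb]] := sumxy v.
exists (fun i => if i == ord0 then a else b).
by rewrite big_ord_recl big_ord1 /= -vb addrC subrK.
Qed.

Theorem theorem2p3 (R : pzRingType) (M : lmodType R) (hM : cu_uniserial M) :
  (nonzero_mod M -> uniform_mod M) /\ bezout_mod M.
Proof.
split=> [nzM | K fgK].
  split=> // N [x Nx x0] L [y Ly y0].
  have [u [v [ux vy sumuv]]] := submod_of_plane x y.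
  have fgK := fin_gen_plane sumuv.
  have [|_ uK] := hM _ fgK; first by exists x; rewrite ?sum_subl ?mem_line.
  have [||z z0 [/lineP[a za] /lineP[b zb]]] :=
    uniform_top_indecomposable fgK uK (x := u) (y := v) _ _ sumuv.
  - by apply: contra x0 => /eqP u0; rewrite -ux u0 raddf0.
  - by apply: contra y0 => /eqP v0; rewrite -vy v0 raddf0.
  exists (val z); split.
  - by rewrite za linearZ /= ux rpredZ.
  - by rewrite zb linearZ /= vy rpredZ.
  - by apply: contra z0 => /eqP vz0; apply/eqP/val_inj; rewrite vz0 raddf0.
have [[x Kx x0]|zeroK] := pselect (nonzero_submod K).
  by have [|cK _] := hM _ fgK; [exists x | apply: cyclic_top].
(* The zero submodule is generated by 0. *)
exists 0 => y; exists 0; rewrite scaler0; apply: val_inj; rewrite raddf0.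
apply: contrapT => /eqP y0; apply: zeroK; exists (val y) => //; exact: valP.
Qed.
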